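(* Let $\ell\in\frac12\mathbb{N}$ and $\nu>0$, let $d\mu(x)=(1-x^2)^{\nu-1/2}dx$ on $[-1,1]$, and let $W^{(\nu)}$ be the symmetric $(2\ell+1)\times(2\ell+1)$ matrix-valued function on $[-1,1]$, with rows and columns indexed by $0,1,\dots,2\ell$, given for $n\ge m$ by $$\big(W^{(\nu)}(x)\big)_{m,n}=\sum_{t=\max(0,n+m-2\ell)}^{m}\alpha_t^{(\nu)}(m,n)\,C^{(\nu)}_{m+n-2t}(x),$$ $$\alpha_t^{(\nu)}(m,n)=(-1)^m\frac{n!\,m!\,(m+n-2t)!}{t!\,(2\nu)_{m+n-2t}\,(\nu)_{n+m-t}}\,\frac{(\nu)_{n-t}(\nu)_{m-t}}{(n-t)!\,(m-t)!}\,\frac{n+m-2t+\nu}{n+m-t+\nu}\,(2\ell-m)!\,(n-2\ell)_{m-t}\,(-2\ell-\nu)_t\,\frac{2\ell+\nu}{(2\ell)!},$$ and by $\big(W^{(\nu)}(x)\big)_{n,m}=\big(W^{(\nu)}(x)\big)_{m,n}$. Let $\Theta(X)=\int_{X\cap[-1,1]}W^{(\nu)}(x)\,d\mu(x)$ for Borel sets $X\subset\mathbb{R}$. Then $\mathscr{A}(\Theta)=A(\Theta)_h$, and this space is the real linear span of $\{I,J\}$, where $I$ is the identity matrix and $J$ is the matrix of the involution $e_j\mapsto e_{2\ell-j}$, $j\in\{0,\dots,2\ell\}$.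
   Context: $\frac12\mathbb{N}=\{0,\frac12,1,\frac32,\dots\}$. $(a)_k=a(a+1)\cdots(a+k-1)$, $(a)_0=1$, is the Pochhammer symbol. $C^{(\nu)}_n$ is the Gegenbauer polynomial, $\sum_{n\ge0}C^{(\nu)}_n(x)s^n=(1-2xs+s^2)^{-\nu}$. $(e_j)_{j=0}^{2\ell}$ is the standard basis of $\mathbb{C}^{2\ell+1}$. For a matrix-valued measure $\Theta$ with values in $M_N(\mathbb{C})$ (here $N=2\ell+1$), with $\mathscr{B}$ the Borel $\sigma$-algebra of $\mathbb{R}$ and $*$ the adjoint (conjugate transpose): $\mathscr{A}(\Theta)=\{T\in M_N(\mathbb{C}) : T\Theta(X)=\Theta(X)T^*\ \forall X\in\mathscr{B}\}$ (a real vector space), $A(\Theta)=\{T\in M_N(\mathbb{C}) : T\Theta(X)=\Theta(X)T\ \forall X\in\mathscr{B}\}$ (the commutant algebra), and $A(\Theta)_h$ is the real vector space of Hermitian matrices in $A(\Theta)$. *)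

(* Defs.v *)
From HB Require Import structures.
From mathcomp Require Import all_boot all_order all_algebra.
From mathcomp Require Import complex.
From mathcomp Require Import all_classical all_reals all_analysis.
Import Order.TTheory GRing.Theory Num.Theory numFieldNormedType.Exports.

Set Implicit Arguments.
Unset Strict Implicit.
Unset Printing Implicit Defensive.

Local Open Scope classical_set_scope.
Local Open Scope ring_scope.
Local Open Scope sesquilinear_scope.

Definition pochhammer (R : nzRingType) (a : R) (k : nat) : R :=
  \prod_(i < k) (a + i%:R).

(* The coefficient of s^n in the expansion of (1 - 2xs + s^2)^(-nu) in powers
   of s.  The base of the power is positive for s near 0, where powR is the
   usual real power. *)
Definition gegenbauer (R : realType) (nu : R) (n : nat) (x : R) : R :=
  derive1n n (fun s : R => (1 - 2 * x * s + s ^+ 2) `^ (- nu)) 0 / n`!%:R.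

(* Throughout, L : nat stands for 2l, so that L ranging over nat amounts to l
   ranging over the nonnegative half-integers. *)
Section Weight.
Variables (R : realType) (L : nat) (nu : R).

(* Only used for t <= m <= n <= L and m + n <= L + t, where the subtractions
   in nat are exact; n - 2l, which is nonpositive, is taken in R. *)
Definition alpha (t m n : nat) : R :=
  (-1) ^+ m
  * ((n`!%:R * m`!%:R * (m + n - 2 * t)`!%:R)
     / (t`!%:R * pochhammer (2 * nu) (m + n - 2 * t)
        * pochhammer nu (n + m - t)))
  * ((pochhammer nu (n - t) * pochhammer nu (m - t))
     / ((n - t)`!%:R * (m - t)`!%:R))
  * (((n + m - 2 * t)%:R + nu) / ((n + m - t)%:R + nu))
  * (L - m)`!%:R * pochhammer (n%:R - L%:R) (m - t)
  * pochhammer (- L%:R - nu) t * ((L%:R + nu) / L`!%:R).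

(* The truncated subtraction m + n - L is max(0, m + n - 2l). *)
Definition weight_entry (m n : nat) (x : R) : R :=
  \sum_(m + n - L <= t < m.+1) alpha t m n * gegenbauer nu (m + n - 2 * t) x.

Definition weight (x : R) : 'M[R]_(L.+1) :=
  \matrix_(m, n) if (m <= n)%N then weight_entry m n x else weight_entry n m x.

Definition weight_measure (X : set R) : 'M[R[i]]_(L.+1) :=
  \matrix_(m, n)
    (\int[lebesgue_measure]_(x in X `&` `[-1, 1])
       (weight x m n * (1 - x ^+ 2) `^ (nu - 2^-1)))%:C%C.

End Weight.

Section Commutants.
Variables (R : realType) (N : nat) (Theta : set R -> 'M[R[i]]_N).

Definition real_commutant : set 'M[R[i]]_N :=
  [set T | forall X : set R, measurable X ->
             T *m Theta X = Theta X *m T ^t*].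

Definition commutant : set 'M[R[i]]_N :=
  [set T | forall X : set R, measurable X -> T *m Theta X = Theta X *m T].

Definition hermitian_commutant : set 'M[R[i]]_N :=
  commutant `&` [set T | T \is hermsymmx].

End Commutants.

Definition real_span2 (R : rcfType) (N : nat) (S T : 'M[R[i]]_N) :
    set 'M[R[i]]_N :=
  [set U | exists a b : R, U = a%:C%C *: S + b%:C%C *: T].

(* Column j is e_(N-1-j), since rev_ord j has value N - 1 - j. *)
Definition flip_mx (R : rcfType) (N : nat) : 'M[R[i]]_N :=
  \matrix_(i, j) (i == rev_ord j)%:R.

(* Main.v *)
(* Expanding the weight in Gegenbauer polynomials, W(x) = sum_d C_d(x) A_d with
   constant matrices A_0, ..., A_2l.  As C_d has degree d, the equations
   T Theta(X) = Theta(X) T^* for X = [-1/2, y], differentiated in y, amount to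
   T A_d = A_d T^* for every d.  The matrix A_0 is diagonal and A_2l is
   antidiagonal, both with positive entries and both commuting with J; together
   they force T_{i,0} = 0 unless i is 0 or 2l, because the ratio of the
   entries of A_2l and A_0 in row i is strictly smaller there than in row 0.
   The column 0 of A_k is a nonzero multiple of e_k, so comparing the
   columns 0 of T A_k and A_k T^* expresses column k of T by the two corner
   entries T_{0,0} and T_{0,2l}, and gives T = T_{0,0} I + T_{0,2l} J.  These
   entries are real.  Conversely W(x) commutes with J because alpha is
   invariant under (t, m, n) |-> (2l + t - m - n, 2l - n, 2l - m). *)

Require Import Defs.
From mathcomp Require Import all_boot all_order all_algebra.
From mathcomp Require Import complex ring lra zify.
From mathcomp Require Import all_classical all_reals all_analysis.
Import Order.TTheory GRing.Theory Num.Theory numFieldNormedType.Exports.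

Local Open Scope ring_scope.
Local Open Scope sesquilinear_scope.

(** * Gegenbauer polynomials *)

Definition gegenbauer_base {R : realType} : {poly {poly R}} :=
  1 - (2%:P * 'X)%:P * 'X + 'X ^+ 2.

(* The outer variable is s, the inner one x; the n-th derivative in s of
   (1 - 2xs + s^2)^(-nu) is this polynomial times (1 - 2xs + s^2)^(-nu-n). *)
Fixpoint gegenbauer_bipoly {R : realType} (nu : R) (n : nat) : {poly {poly R}} :=
  if n is n'.+1 then
    (gegenbauer_bipoly nu n')^`() * gegenbauer_base
    - (nu + n'%:R)%:P%:P * gegenbauer_bipoly nu n' * gegenbauer_base^`()
  else 1.

(** At s = 0 the power factor equals 1, so this is n! C_n as a polynomial in x; [gegenbauerE]
    divides by n!. *)
Definition gegenbauer_poly {R : realType} (nu : R) (n : nat) : {poly R} :=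
  (gegenbauer_bipoly nu n)`_0.

Lemma horner_gegenbauer_base {R : realType} (x s : R) :
  (map_poly (horner_eval x) gegenbauer_base).[s] = 1 - 2 * x * s + s ^+ 2.
Proof.
rewrite /gegenbauer_base rmorphD rmorphB rmorphM rmorphXn rmorph1 /=.
rewrite map_polyC map_polyX.
by rewrite !hornerE /= /horner_eval !hornerE.
Qed.

(** Induction by the product and chain rules: each derivative in s lowers the exponent by one and
    applies the recursion of [gegenbauer_bipoly]. *)
Lemma derive1n_gegenbauer {R : realType} (nu x : R) (n : nat) (s : R) :
  0 < 1 - 2 * x * s + s ^+ 2 ->
  derive1n n (fun s => (1 - 2 * x * s + s ^+ 2) `^ (- nu)) s =
  (map_poly (horner_eval x) (gegenbauer_bipoly nu n)).[s]
  * (1 - 2 * x * s + s ^+ 2) `^ (- nu - n%:R).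
Proof.
elim: n s => [|n IHn] s s_gt0.
  by rewrite /= rmorph1 hornerC mul1r subr0.
rewrite derive1nS derive1E.
set g := map_poly (horner_eval x) gegenbauer_base.
set q := map_poly (horner_eval x) (gegenbauer_bipoly nu n).
have gE t : 1 - 2 * x * t + t ^+ 2 = g.[t].
  by rewrite horner_gegenbauer_base.
have gs_gt0 : 0 < g.[s] by rewrite -gE.
(* The induction hypothesis is differentiated at [s], so it must hold on a whole neighbourhood. *)
have near_g : \forall t \near s, 0 < g.[t].
  have := @continuous_horner _ g s.
  by move/cvgr_gt; apply.
rewrite (@near_eq_derive R R R _
  (horner q * ((fun y : R => y `^ (- nu - n%:R)) \o horner g))); last first.
  near=> t; rewrite IHn ?gE//.
  by near: t.
pose H := is_derive1_comp (is_derive1_powR (- nu - n%:R) gs_gt0) (is_derive_poly g s).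
have := is_deriveM (is_derive_poly q s) H.
move=> [_ ->]; rewrite gE /= rmorphB !rmorphM /= -!deriv_map -/g -/q !map_polyC /=.
rewrite !hornerE /horner_eval hornerC /=.
have -> : - nu - n.+1%:R = - nu - n%:R - 1 :> R by rewrite -natr1; ring.
rewrite /GRing.scale /=.
(* Splitting off one factor of the base gives both summands the exponent -nu-n-1. *)
have {1}-> : g.[s] `^ (- nu - n%:R) = g.[s] * g.[s] `^ (- nu - n%:R - 1).
  rewrite -{2}(powRr1 (ltW gs_gt0)) -powRD; first by congr (_ `^ _); ring.
  by rewrite (gt_eqF gs_gt0) implybT.
ring.
Unshelve. all: by end_near.
Qed.

Lemma gegenbauerE {R : realType} (nu : R) (n : nat) (x : R) :
  gegenbauer nu n x = (gegenbauer_poly nu n).[x] / n`!%:R.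
Proof.
rewrite /gegenbauer derive1n_gegenbauer; last by rewrite mulr0 subr0 expr0n /= addr0 ltr01.
rewrite mulr0 subr0 expr0n /= addr0 powR1 mulr1.
by rewrite horner_coef0 coef_map.
Qed.

(** Bounds on the degree in x, uniform over the powers of s, add up under products. *)
Lemma size_coefM_bipoly {R : idomainType} (a b : nat) (p q : {poly {poly R}}) :
  (forall j, (size (p`_j)%R <= a.+1)%N) -> (forall j, (size (q`_j)%R <= b.+1)%N) ->
  forall j, (size ((p * q)`_j)%R <= (a + b).+1)%N.
Proof.
move=> sp sq j; rewrite coefM (leq_trans (size_sum _ _ _))//.
apply/bigmax_leqP => i _; rewrite (leq_trans (size_polyMleq _ _))//.
have := sp i; have := sq (j - i)%N; lia.
Qed.

Lemma size_coef_deriv_bipoly {R : idomainType} (a : nat) (p : {poly {poly R}}) :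
  (forall j, (size (p`_j)%R <= a.+1)%N) -> forall j, (size (p^`()`_j)%R <= a.+1)%N.
Proof.
by move=> sp j; rewrite coef_deriv -scaler_nat (leq_trans (size_scale_leq _ _)).
Qed.

Lemma size_coef_gegenbauer_base {R : realType} (j : nat) :
  (size ((@gegenbauer_base R)`_j)%R <= 2)%N.
Proof.
rewrite /gegenbauer_base coefD coefB coef1 coefMX coefC coefXn.
have s2X : (size (2%:P * 'X : {poly R})%R <= 2)%N.
  by rewrite (leq_trans (size_polyMleq _ _))// size_polyX addn2 /= ltnS size_polyC_leq1.
case: j => [|[|[|j]]] /=.
- by rewrite subr0 addr0 size_poly1.
- by rewrite sub0r addr0 size_polyN.
- by rewrite subr0 add0r size_poly1.
- by rewrite subr0 addr0 size_poly0.
Qed.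

Lemma size_gegenbauer_bipoly {R : realType} (nu : R) (n j : nat) :
  (size ((gegenbauer_bipoly nu n)`_j)%R <= n.+1)%N.
Proof.
elim: n j => [|n IHn] j; first by rewrite coef1; case: eqP; rewrite ?size_poly1 ?size_poly0.
have sb := @size_coef_gegenbauer_base R.
rewrite /= coefB (leq_trans (size_polyD _ _))// geq_max size_polyN -addn1.
rewrite size_coefM_bipoly//=; last exact: size_coef_deriv_bipoly.
rewrite size_coefM_bipoly//; last exact: size_coef_deriv_bipoly.
by move=> i; rewrite coefCM mul_polyC (leq_trans (size_scale_leq _ _)).
Qed.

(** At s = 0 the base is 1 and its derivative is -2x. The first term of the recursion then has
    degree at most n in x, so only 2x(nu+n) times the previous polynomial reaches x^(n+1). *)
Lemma coef_gegenbauer_poly {R : realType} (nu : R) (n : nat) :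
  (gegenbauer_poly nu n)`_n = 2 ^+ n * pochhammer nu n.
Proof.
rewrite /gegenbauer_poly /pochhammer; elim: n => [|n IHn].
  by rewrite /= coef1 big_ord0 mulr1 coef1.
have base0 : (@gegenbauer_base R)`_0 = 1.
  by rewrite /gegenbauer_base coefD coefB coef1 coefMX coefXn /= subr0 addr0.
have base1 : (@gegenbauer_base R)^`()`_0 = - (2%:P * 'X).
  by rewrite /gegenbauer_base coef_deriv coefD coefB coef1 coefMX coefC coefXn /= sub0r addr0.
rewrite /= coefB !coef0M base0 base1 mulr1 coefC eqxx coef_deriv coefB.
rewrite mulr1n nth_default ?size_gegenbauer_bipoly//.
rewrite mulrN coefN sub0r opprK -!mulrA coefCM mulrCA coefCM mulrA coefMX /=.
rewrite IHn big_ord_recr exprS /=; ring.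
Qed.

(** As nu > 0, C_d has degree exactly d. A combination vanishing on an interval is the zero
    polynomial; its top coefficient vanishes, and induction does the rest. *)
Lemma gegenbauer_free {R : realType} (nu : R) (L : nat) (c : nat -> R) :
  0 < nu ->
  (forall x, - 2^-1 < x < 2^-1 -> \sum_(d < L.+1) c d * gegenbauer nu d x = 0) ->
  forall d, (d <= L)%N -> c d = 0.
Proof.
move=> nu_gt0; set G := @gegenbauer_poly R nu.
have GdE d : (G d)`_d != 0.
  rewrite coef_gegenbauer_poly mulf_neq0 ?expf_neq0 ?pnatr_eq0//.
  by apply/prodf_neq0 => i _; rewrite gt_eqF// ltr_wpDr.
elim: L => [|L IHL] cG0 d.
- rewrite leqn0 => /eqP ->.
  have := cG0 0; rewrite big_ord1 gegenbauerE /gegenbauer_poly /= coef1 hornerC.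
  by rewrite invr1 !mulr1; apply; lra.
- pose p := \sum_(d < L.+2) (c d / d`!%:R) *: G d.
  have p0 : p = 0.
    apply/eqP/negPn/negP => pn0.
    (* The points 1/(i+3) are distinct and lie in (0, 1/2); there are [size p] of them, one more
       than the degree of [p]. *)
    pose rs := [seq (i%:R + 3)^-1 : R | i <- iota 0 (size p)].
    have := max_poly_roots (rs := rs) pn0; rewrite size_map size_iota ltnn; move=> H.
    suff // : false by [].
    apply: H.
      apply/allP => _ /mapP[i _ ->]; rewrite /root horner_sum.
      have i0 : 0 <= i%:R :> R by [].
      rewrite -[X in _ == X](cG0 (i%:R + 3)^-1); last first.
        have i3 : 0 < (i%:R + 3 : R)^-1 by rewrite invr_gt0; lra.
        have : (i%:R + 3 : R)^-1 < 2^-1 by rewrite ltf_pV2 ?posrE; lra.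
        by move: ((i%:R + 3)^-1) i3 => y; lra.
      by apply/eqP/eq_bigr => j _; rewrite hornerZ gegenbauerE mulrAC mulrA.
    rewrite map_inj_uniq ?iota_uniq// => i j /invr_inj /addIr /eqP.
    by rewrite eqr_nat => /eqP.
  have cL : c L.+1 = 0.
    have := congr1 (fun q : {poly R} => q`_L.+1) p0; rewrite coef0 coef_sum.
    rewrite big_ord_recr /= big1 ?add0r; last first.
      by move=> i _; rewrite coefZ nth_default ?mulr0// (leq_trans (size_gegenbauer_bipoly _ _ _)).
    rewrite coefZ => /eqP; rewrite !mulf_eq0 invr_eq0 pnatr_eq0 (negbTE (GdE _)).
    by rewrite -[(_ == 0)%N]negbK -lt0n fact_gt0 !orbF => /eqP.
  rewrite leq_eqVlt => /predU1P[-> //|]; rewrite ltnS; apply: IHL => x xI.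
  by have := cG0 x xI; rewrite big_ord_recr /= cL mul0r addr0.
Qed.

(** * The coefficients of the weight *)

Lemma pochhammer_gt0 {R : realFieldType} (a : R) (k : nat) : 0 < a -> 0 < pochhammer a k.
Proof. by move=> a0; apply: prodr_gt0 => i _; rewrite ltr_wpDr. Qed.

Lemma pochhammer0 {R : nzRingType} (a : R) : pochhammer a 0 = 1.
Proof. exact: big_ord0. Qed.

Lemma pochhammerS {R : nzRingType} (a : R) (k : nat) :
  pochhammer a k.+1 = pochhammer a k * (a + k%:R).
Proof. exact: big_ord_recr. Qed.

Lemma pochhammerD {R : nzRingType} (a : R) (m k : nat) :
  pochhammer a (m + k) = pochhammer a m * pochhammer (a + m%:R) k.
Proof.
rewrite /pochhammer big_split_ord; congr (_ * _).
by apply: eq_bigr => i _; rewrite natrD addrA.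
Qed.

(** Reversing signs and order gives (1-a-n)_k = (-1)^k (a+n-k)_k, the last k factors of (a)_n. This
    trades the negative arguments in [alpha] for positive ones. *)
Lemma pochhammer_refl {R : comNzRingType} (a : R) (n k : nat) : (k <= n)%N ->
  pochhammer (1 - a - n%:R) k * pochhammer a (n - k) = (-1) ^+ k * pochhammer a n.
Proof.
elim: k => [|k IHk] kn; first by rewrite subn0 pochhammer0.
rewrite exprS -mulrA -IHk ?(ltnW kn)// -(subnSK kn) !pochhammerS natrB//.
by rewrite -natr1; ring.
Qed.

Lemma pochhammer1 {R : nzRingType} (n : nat) : pochhammer (1 : R) n = n`!%:R.
Proof.
elim: n => [|n IHn]; first by rewrite pochhammer0.
by rewrite pochhammerS IHn nat1r factS mulnC natrM.
Qed.

(* All factors are positive, and the terms are grouped so that each group is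
   invariant under (t, m, n) |-> (L + t - m - n, L - n, L - m). *)
Lemma alphaE {R : realType} (L : nat) (nu : R) (t m n : nat) : 0 < nu ->
  (t <= m)%N -> (m <= n)%N -> (n <= L)%N -> (m + n <= L + t)%N ->
  alpha L nu t m n =
  (L%:R + nu) * pochhammer nu L.+1 / L`!%:R
  * ((m`!%:R * n`!%:R * ((L - m)`!%:R * (L - n)`!%:R))
     / (t`!%:R * (L + t - (m + n))`!%:R
        * (pochhammer nu (L.+1 - t) * pochhammer nu (m + n - t).+1)))
  * ((m + n - 2 * t)`!%:R * ((m + n - 2 * t)%:R + nu)
     / pochhammer (2 * nu) (m + n - 2 * t))
  * (pochhammer nu (n - t) * pochhammer nu (m - t)
     / ((n - t)`!%:R * (m - t)`!%:R)).
Proof.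
move=> nu_gt0 tm mn nL mnL; rewrite /alpha.
have fact_neq0 k : k`!%:R != 0 :> R by rewrite pnatr_eq0 -lt0n fact_gt0.
have poch_neq0 a k : 0 < a -> pochhammer a k != 0 :> R.
  by move=> a0; rewrite gt_eqF// pochhammer_gt0.
(* Reflection with a = 1 and length L - n. *)
have -> : pochhammer (n%:R - L%:R) (m - t) =
    (-1) ^+ (m - t) * (L - n)`!%:R / (L + t - (m + n))`!%:R :> R.
  have H : (m - t <= L - n)%N by lia.
  have := pochhammer_refl (1 : R) _ _ H; rewrite !pochhammer1 natrB// => <-.
  have -> : (L - n - (m - t) = L + t - (m + n))%N by lia.
  by rewrite mulfK//; congr pochhammer; ring.
(* Reflection with a = nu and length L + 1. *)
have -> : pochhammer (- L%:R - nu) t =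
    (-1) ^+ t * pochhammer nu L.+1 / pochhammer nu (L.+1 - t).
  rewrite -pochhammer_refl; last by lia.
  by rewrite mulfK ?poch_neq0//; congr pochhammer; rewrite -natr1; ring.
rewrite (addnC n m) (pochhammerS nu (m + n - t)) (addrC nu).
(* The sign of [alpha] splits into exactly the two signs produced by the reflections, so everything
   cancels in squares. *)
have -> : (-1) ^+ m = (-1) ^+ (m - t) * (-1) ^+ t :> R by rewrite -exprD subnK.
have s1 : (-1) ^+ (m - t) * (-1) ^+ (m - t) = 1 :> R by rewrite -expr2 sqrr_sign.
have s2 : (-1) ^+ t * (-1) ^+ t = 1 :> R by rewrite -expr2 sqrr_sign.
have k_neq0 : (m + n - t)%:R + nu != 0 by rewrite gt_eqF// ltr_wpDl.
have nu2 : 0 < 2 * nu by lra.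
move: s1 s2 k_neq0 (fact_neq0 t) (fact_neq0 (L + t - (m + n))%N) (fact_neq0 L)
  (fact_neq0 (n - t)%N) (fact_neq0 (m - t)%N) (poch_neq0 nu (L.+1 - t)%N nu_gt0)
  (poch_neq0 nu (m + n - t)%N nu_gt0) (poch_neq0 _ (m + n - 2 * t)%N nu2).
clear; move: ((-1) ^+ (m - t)) ((-1) ^+ t) => e1 e2 e1E e2E.
move=> *.
transitivity (e1 * e1 * (e2 * e2) * (L%:R + nu) * pochhammer nu L.+1 / L`!%:R
  * ((m`!%:R * n`!%:R * ((L - m)`!%:R * (L - n)`!%:R))
     / (t`!%:R * (L + t - (m + n))`!%:R
        * (pochhammer nu (L.+1 - t) * (pochhammer nu (m + n - t) * ((m + n - t)%:R + nu)))))
  * ((m + n - 2 * t)`!%:R * ((m + n - 2 * t)%:R + nu)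
     / pochhammer (2 * nu) (m + n - 2 * t))
  * (pochhammer nu (n - t) * pochhammer nu (m - t)
     / ((n - t)`!%:R * (m - t)`!%:R))).
  by field; do ?[apply/andP; split].
by rewrite e1E e2E !mul1r.
Qed.

Lemma alpha_gt0 {R : realType} (L : nat) (nu : R) (t m n : nat) : 0 < nu ->
  (t <= m)%N -> (m <= n)%N -> (n <= L)%N -> (m + n <= L + t)%N ->
  0 < alpha L nu t m n.
Proof.
move=> nu_gt0 tm mn nL mnL; rewrite alphaE//.
have fact_gt0 k : 0 < k`!%:R :> R by rewrite ltr0n fact_gt0.
have nu2 : 0 < 2 * nu by lra.
by rewrite !(mulr_gt0, invr_gt0, fact_gt0, pochhammer_gt0, ltr_wpDl).
Qed.

Lemma alpha_flip {R : realType} (L : nat) (nu : R) (t m n : nat) : 0 < nu ->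
  (t <= m)%N -> (m <= n)%N -> (n <= L)%N -> (m + n <= L + t)%N ->
  alpha L nu (L + t - (m + n)) (L - n) (L - m) = alpha L nu t m n.
Proof.
move=> nu_gt0 tm mn nL mnL; rewrite !alphaE//; try lia.
rewrite !subKn ?(leq_trans mn)//.
have -> : (L + (L + t - (m + n)) - (L - n + (L - m)) = t)%N by lia.
have -> : (L.+1 - (L + t - (m + n)) = (m + n - t).+1)%N by lia.
have -> : ((L - n + (L - m) - (L + t - (m + n))).+1 = L.+1 - t)%N by lia.
have -> : (L - n + (L - m) - 2 * (L + t - (m + n)) = m + n - 2 * t)%N by lia.
have -> : (L - m - (L + t - (m + n)) = n - t)%N by lia.
have -> : (L - n - (L + t - (m + n)) = m - t)%N by lia.
congr (_ * (_ / _) * _ * _); ring.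
Qed.

(** The Gegenbauer values are replaced by an arbitrary sequence [F]: in [alpha_mx], F d = C_d(x)
    yields W(x), and [indic d] yields the coefficient matrix A_d. *)
Definition alpha_sum {R : realType} (L : nat) (nu : R) (F : nat -> R) (m n : nat) : R :=
  \sum_(m + n - L <= t < m.+1) alpha L nu t m n * F (m + n - 2 * t)%N.

Definition alpha_mx {R : realType} (L : nat) (nu : R) (F : nat -> R) : 'M[R]_L.+1 :=
  \matrix_(i, j) if (i <= j)%N then alpha_sum L nu F i j else alpha_sum L nu F j i.

Definition indic {R : realType} (d k : nat) : R := (k == d)%:R.

Lemma alpha_sum_flip {R : realType} (L : nat) (nu : R) (F : nat -> R) (m n : nat) :
  0 < nu -> (m <= n)%N -> (n <= L)%N ->
  alpha_sum L nu F (L - n) (L - m) = alpha_sum L nu F m n.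
Proof.
move=> nu_gt0 mn nL; rewrite /alpha_sum.
(* Both sums are shifted to start at 0; the involution on t then becomes the identity on the shifted
   index. *)
rewrite -[(m + n - L)%N]add0n -[(L - n + (L - m) - L)%N]add0n !big_addn.
have -> : ((L - n).+1 - (L - n + (L - m) - L) = m.+1 - (m + n - L))%N by lia.
apply: eq_big_nat => i /andP[_ iL].
rewrite -(@alpha_flip _ _ _ (i + (m + n - L)))//; try lia.
have -> : (L + (i + (m + n - L)) - (m + n) = i + (L - n + (L - m) - L))%N by lia.
have -> : (L - n + (L - m) - 2 * (i + (L - n + (L - m) - L)) =
  m + n - 2 * (i + (m + n - L)))%N by lia.
by [].
Qed.

Lemma alpha_sum_expand {R : realType} (L : nat) (nu : R) (F : nat -> R) (m n : nat) :
  alpha_sum L nu F m n = \sum_(d < L.+1) F d * alpha_sum L nu (indic d) m n.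
Proof.
under eq_bigr do rewrite mulr_sumr.
rewrite exchange_big /=; apply: eq_big_nat => t /andP[tmn _].
(* The lower limit on t keeps the degree at most L. *)
have kL : (m + n - 2 * t < L.+1)%N by lia.
rewrite (bigD1 (Ordinal kL))//= big1 ?addr0; last first.
  by move=> d; rewrite -val_eqE /indic eq_sym /= => /negbTE ->; rewrite /= mulr0n !mulr0.
by rewrite /indic eqxx /= mulr1n mulr1 mulrC.
Qed.

(** Degree 0 means 2t = m + n, which with t <= m <= n forces t = m = n: A_0 is diagonal. *)
Lemma alpha_sum_indic0 {R : realType} (L : nat) (nu : R) (m n : nat) :
  (m <= n)%N -> (n <= L)%N ->
  alpha_sum L nu (indic 0) m n = (m == n)%:R * alpha L nu m m n.
Proof.
move=> mn nL; rewrite /alpha_sum /indic big_nat_recr /=; last by lia.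
rewrite big1_seq ?add0r; last first.
  move=> t; rewrite mem_index_iota => /andP[_ tm].
  have -> : (m + n - 2 * t == 0)%N = false by lia.
  by rewrite /= mulr0n mulr0.
have -> : (m + n - 2 * m == 0)%N = (m == n) by lia.
by rewrite mulrC.
Qed.

(** From m + n = L + 2t and t >= m + n - L follow t = 0 and m + n = L: A_2l is antidiagonal. *)
Lemma alpha_sum_indicL {R : realType} (L : nat) (nu : R) (m n : nat) :
  (m <= n)%N -> (n <= L)%N ->
  alpha_sum L nu (indic L) m n = (m + n == L)%:R * alpha L nu 0 m n.
Proof.
move=> mn nL; rewrite /alpha_sum /indic big_ltn; last by lia.
rewrite big1_seq ?addr0; last first.
  move=> t; rewrite mem_index_iota => /andP[_ tm].
  have -> : (m + n - 2 * t == L)%N = false by lia.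
  by rewrite /= mulr0n mulr0.
have -> : (m + n - 2 * (m + n - L) == L)%N = (m + n == L)%N by lia.
by case: eqP => [->|_]; rewrite /= ?mulr0n ?mulr1n ?mulr0 ?mul0r// subnn mulrC.
Qed.

Lemma alpha_sum_indic_row0 {R : realType} (L : nat) (nu : R) (k n : nat) :
  (n <= L)%N -> alpha_sum L nu (indic k) 0 n = (n == k)%:R * alpha L nu 0 0 n.
Proof.
move=> nL; rewrite /alpha_sum add0n (eqP nL) big_nat1 /indic subn0.
by rewrite mulrC.
Qed.

Lemma alpha_mx_flip {R : realType} (L : nat) (nu : R) (F : nat -> R) (i j : 'I_L.+1) :
  0 < nu -> alpha_mx L nu F (rev_ord i) (rev_ord j) = alpha_mx L nu F i j.
Proof.
move=> nu_gt0; rewrite !mxE /= !subSS.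
have iL := ltn_ord i; have jL := ltn_ord j.
case: (ltngtP i j) => [ij|ji|<-].
- have -> : (L - i <= L - j)%N = false by lia.
  by rewrite alpha_sum_flip//; lia.
- have -> : (L - i <= L - j)%N by lia.
  by rewrite alpha_sum_flip//; lia.
- by rewrite leqnn alpha_sum_flip.
Qed.

Lemma alpha_mx_expand {R : realType} (L : nat) (nu : R) (F : nat -> R) :
  alpha_mx L nu F = \sum_(d < L.+1) F d *: alpha_mx L nu (indic d).
Proof.
apply/matrixP => i j; rewrite summxE !mxE.
under eq_bigr do rewrite !mxE.
by case: ifP => _; rewrite alpha_sum_expand.
Qed.

(** * Comparison of the entries of A_2l and A_0 *)

Lemma alpha_diag {R : realType} (L : nat) (nu : R) (m : nat) : 0 < nu -> (m <= L)%N ->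
  alpha L nu m m m =
  (L%:R + nu) * pochhammer nu L.+1 / L`!%:R * nu
  * (m`!%:R * (L - m)`!%:R / (pochhammer nu (L - m).+1 * pochhammer nu m.+1)).
Proof.
move=> nu_gt0 mL; rewrite alphaE//; last by lia.
have -> : (L + m - (m + m) = L - m)%N by lia.
have -> : (m + m - 2 * m = 0)%N by lia.
rewrite addnK subnn subSn// add0r !pochhammer0 fact0.
have fact_neq0 k : k`!%:R != 0 :> R by rewrite pnatr_eq0 -lt0n fact_gt0.
have poch_neq0 k : pochhammer nu k != 0 :> R by rewrite gt_eqF// pochhammer_gt0.
by field; rewrite !fact_neq0 !poch_neq0.
Qed.

(** As in [alpha_diag], the constants free of m are kept apart, since they cancel when rows are
    compared. *)
Lemma alpha_antidiag {R : realType} (L : nat) (nu : R) (m : nat) : 0 < nu -> (m <= L - m)%N ->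
  alpha L nu 0 m (L - m) =
  (L%:R + nu) ^+ 2 / (pochhammer nu L.+1 * pochhammer (2 * nu) L)
  * (m`!%:R * (L - m)`!%:R * (pochhammer nu m * pochhammer nu (L - m))).
Proof.
move=> nu_gt0 mL; rewrite alphaE//; try lia.
have -> : (m + (L - m) = L)%N by lia.
rewrite addn0 subnn muln0 !subn0 fact0 subKn; last by lia.
have fact_neq0 k : k`!%:R != 0 :> R by rewrite pnatr_eq0 -lt0n fact_gt0.
have poch_neq0 a k : 0 < a -> pochhammer a k != 0 :> R.
  by move=> a0; rewrite gt_eqF// pochhammer_gt0.
have nu2 : 0 < 2 * nu by lra.
by field; rewrite !fact_neq0 !poch_neq0.
Qed.

Lemma ltr_pochhammer {R : realFieldType} (a b : R) (k : nat) :
  0 < a -> a < b -> (0 < k)%N -> pochhammer a k < pochhammer b k.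
Proof.
move=> a_gt0 ab k_gt0; rewrite /pochhammer; apply: ltr_prod.
  by apply/hasP; exists (Ordinal k_gt0) => //; rewrite mem_index_enum.
by move=> i _; rewrite ltrD2r ab andbT addr_ge0// ltW.
Qed.

(* This separates the two extreme indices 0 and L from all the others, by
   log-convexity of k |-> (nu)_k. *)
Lemma alpha_ratio_lt {R : realType} (L : nat) (nu : R) (m : nat) : 0 < nu ->
  (0 < m)%N -> (m <= L - m)%N ->
  alpha L nu 0 m (L - m) * alpha L nu 0 0 0 < alpha L nu 0 0 L * alpha L nu m m m.
Proof.
move=> nu_gt0 m_gt0 mL.
have := @alpha_antidiag R L nu 0 nu_gt0 (leq0n _); rewrite subn0 => ->.
rewrite alpha_antidiag// !alpha_diag//; last by lia.
have fact_gt0 k : 0 < k`!%:R :> R by rewrite ltr0n fact_gt0.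
have poch_gt0 a k : 0 < a -> 0 < pochhammer a k :> R by apply: pochhammer_gt0.
(* Cut (nu)_L at L - m; the remaining block (nu+L-m)_m exceeds (nu)_m factor by factor. *)
have H1 : pochhammer nu m * pochhammer nu (L - m) < pochhammer nu 0 * pochhammer nu L.
  have -> : pochhammer nu L = pochhammer nu (L - m) * pochhammer (nu + (L - m)%:R) m.
    by rewrite -pochhammerD subnK; last by lia.
  rewrite pochhammer0 mul1r mulrC ltr_pM2l ?poch_gt0// ltr_pochhammer// ltrDl ltr0n; lia.
(* The same comparison after taking out the first factor nu: (nu+1)_m against (nu+L-m+1)_m. *)
have H2 : pochhammer nu m.+1 * pochhammer nu (L - m).+1
    < pochhammer nu 1 * pochhammer nu L.+1.
  have -> : pochhammer nu L.+1 =
      pochhammer nu (L - m).+1 * pochhammer (nu + (L - m).+1%:R) m.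
    by rewrite -pochhammerD addSn subnK; last by lia.
  rewrite -[m.+1]add1n pochhammerD (mulrC (pochhammer nu (L - m).+1)) mulrA.
  rewrite ltr_pM2r ?poch_gt0// ltr_pM2l ?poch_gt0//.
  rewrite ltr_pochhammer ?addr_gt0// ltrD2l ltr_nat; lia.
set E1 := _ / (pochhammer nu L.+1 * _); set E2 := _ / L`!%:R * nu.
have E_gt0 : 0 < E1 * E2 * m`!%:R * (L - m)`!%:R * L`!%:R.
  have nu2 : 0 < 2 * nu by lra.
  by rewrite /E1 /E2 !(mulr_gt0, invr_gt0, exprn_gt0, fact_gt0, poch_gt0, ltr_wpDl).
set q := pochhammer nu m * _ in H1 *; set q0 := pochhammer nu 0 * _ in H1 *.
rewrite [pochhammer nu (L - m).+1 * _]mulrC.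
set r := pochhammer nu m.+1 * _ in H2 *.
rewrite subn0 [pochhammer nu L.+1 * _]mulrC.
set r0 := pochhammer nu 1 * _ in H2 *.
have r_gt0 : 0 < r by rewrite mulr_gt0 ?poch_gt0.
have r0_gt0 : 0 < r0 by rewrite mulr_gt0 ?poch_gt0.
have q_gt0 : 0 < q by rewrite mulr_gt0 ?poch_gt0.
rewrite fact0 -subr_gt0.
have -> : E1 * (1 * L`!%:R * q0) * (E2 * (m`!%:R * (L - m)`!%:R / r)) -
    E1 * (m`!%:R * (L - m)`!%:R * q) * (E2 * (1 * L`!%:R / r0)) =
    (E1 * E2 * m`!%:R * (L - m)`!%:R * L`!%:R) * (q0 * r0 - q * r) / (r * r0).
  by field; rewrite !gt_eqF.
apply: divr_gt0; last exact: mulr_gt0.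
by apply: mulr_gt0 => //; rewrite subr_gt0 ltr_pM// ltW.
Qed.

Lemma alpha_mx_indic0 {R : realType} (L : nat) (nu : R) (i j : 'I_L.+1) :
  alpha_mx L nu (indic 0) i j = (i == j)%:R * alpha L nu i i i.
Proof.
have iL := ltn_ord i; have jL := ltn_ord j.
rewrite mxE -val_eqE /=; case: leqP => ij.
  rewrite alpha_sum_indic0//; have [->|_] := eqVneq (i : nat) j; first by [].
  by rewrite !mul0r.
by rewrite alpha_sum_indic0// ?(ltnW ij)// (ltn_eqF ij) (gtn_eqF ij) !mul0r.
Qed.

Lemma alpha_mx_indicL {R : realType} (L : nat) (nu : R) (i j : 'I_L.+1) :
  alpha_mx L nu (indic L) i j =
  (j == rev_ord i)%:R * (if (i <= L - i)%N then alpha L nu 0 i (L - i)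
                         else alpha L nu 0 (L - i) i).
Proof.
have iL := ltn_ord i; have jL := ltn_ord j.
rewrite mxE -val_eqE /= subSS; case: leqP => ij.
  rewrite alpha_sum_indicL//.
  have -> : (i + j == L)%N = (j == (L - i)%N :> nat) by lia.
  have [jE|_] := eqVneq (j : nat) (L - i)%N; last by rewrite !mul0r.
  by rewrite -jE ij.
rewrite alpha_sum_indicL// ?(ltnW ij)//.
have -> : (j + i == L)%N = (j == (L - i)%N :> nat) by lia.
have [jE|_] := eqVneq (j : nat) (L - i)%N; last by rewrite !mul0r.
by rewrite -jE leqNgt ij.
Qed.

Lemma alpha_mx_indic_col0 {R : realType} (L : nat) (nu : R) (k : nat) (i : 'I_L.+1) :
  alpha_mx L nu (indic k) i ord0 = (i == k :> nat)%:R * alpha L nu 0 0 i.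
Proof.
have iL := ltn_ord i; rewrite mxE /=; case: leqP => i0; rewrite -alpha_sum_indic_row0//.
by congr alpha_sum; lia.
Qed.

(** * Rigidity *)

(** Pure linear algebra: [A k] stands for A_k, and the hypotheses are the properties of these
    matrices on which the argument rests. *)
Lemma twisted_commutant_rigid {C : numClosedFieldType} (L : nat)
    (A : 'I_L.+1 -> 'M[C]_L.+1) (T : 'M[C]_L.+1) :
  (forall k i j, A k (rev_ord i) (rev_ord j) = A k i j) ->
  (forall i, 0 < A ord0 i i) -> (forall i j, i != j -> A ord0 i j = 0) ->
  (forall i, 0 < A ord_max i (rev_ord i)) ->
  (forall i j, j != rev_ord i -> A ord_max i j = 0) ->
  (forall k, A k k ord0 != 0) -> (forall k i, i != k -> A k i ord0 = 0) ->
  (forall i, i != ord0 -> i != ord_max ->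
     A ord_max i (rev_ord i) * A ord0 ord0 ord0
     != A ord_max ord0 (rev_ord ord0) * A ord0 i i) ->
  (forall k, T *m A k = A k *m T ^t*) ->
  exists a b : C, [/\ a^* = a, b^* = b &
    T = a *: 1%:M + b *: (\matrix_(i, j) (i == rev_ord j)%:R)].
Proof.
move=> Aflip A0_gt0 A0_diag AL_gt0 AL_anti Acol_neq0 Acol0 sep TA.
pose d i := A ord0 i i; pose l i := A ord_max i (rev_ord i).
have d_neq0 i : d i != 0 by rewrite gt_eqF// A0_gt0.
have drev i : d (rev_ord i) = d i by rewrite /d Aflip.
have lrev i : l (rev_ord i) = l i by rewrite /l Aflip.
have rev0 : rev_ord ord0 = ord_max :> 'I_L.+1 by apply/val_inj; rewrite /= subn1.
have TAE k i j : \sum_h T i h * A k h j = \sum_h A k i h * (T j h)^*.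
  have /matrixP/(_ i j) := TA k; rewrite !mxE => ->.
  by apply: eq_bigr => h _; rewrite !mxE.
have TA0 i j : T i j * d j = d i * (T j i)^*.
  have := TAE ord0 i j; rewrite (bigD1 j)//= big1 ?addr0; last first.
    by move=> h hj; rewrite A0_diag ?mulr0.
  by rewrite (bigD1 i)//= big1 ?addr0// => h hi; rewrite A0_diag ?mul0r// eq_sym.
have TAL i j : T i (rev_ord j) * l j = l i * (T j (rev_ord i))^*.
  have := TAE ord_max i j; rewrite (bigD1 (rev_ord j))//= big1 ?addr0; last first.
    move=> h hj; rewrite AL_anti ?mulr0//.
    by apply: contra hj => /eqP ->; rewrite rev_ordK.
  rewrite (bigD1 (rev_ord i))//= big1 ?addr0; last first.
    by move=> h hi; rewrite AL_anti ?mul0r.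
  by rewrite -[X in A _ _ X]rev_ordK -/(l _) lrev.
(* Eliminating the conjugate entry between the relations for A_2l and A_0 leaves a linear relation
   between entries of T. *)
have Tswap i j : T i (rev_ord j) * (l j * d i) = T (rev_ord i) j * (l i * d j).
  by rewrite mulrA TAL -mulrA (mulrC _ (d i)) -(drev i) -TA0; ring.
have revL : rev_ord ord_max = ord0 :> 'I_L.+1 by rewrite -rev0 rev_ordK.
have Tcol0 i : i != ord0 -> i != ord_max -> T i ord0 = 0.
  move=> i0 iL.
  (* Two instances give u x = v y and v x = u y, where x = l_0 d_i and y = l_i d_0. Hence u (x^2 -
     y^2) = 0, with x != y by [sep] and x + y > 0. *)
  have := Tswap i ord_max; have := Tswap (rev_ord i) ord0.
  rewrite rev_ordK rev0 revL -rev0 !lrev !drev rev0.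
  set u := T i ord0; set v := T _ ord_max.
  have : l ord0 * d i != l i * d ord0 by rewrite eq_sym sep.
  have : 0 < l ord0 * d i + l i * d ord0.
    by rewrite addr_gt0// mulr_gt0// ?A0_gt0 ?AL_gt0.
  move: (l ord0 * d i) (l i * d ord0) => x y /gt_eqF xy_neq0 xy vE uE.
  have : u * ((x - y) * (x + y)) = 0.
    transitivity (u * x * x - u * y * y); first by ring.
    by rewrite uE -vE; ring.
  by move/eqP; rewrite !mulf_eq0 subr_eq0 (negbTE xy) xy_neq0 !orbF => /eqP.
have Trow0 j : j != ord0 -> j != ord_max -> T ord0 j = 0.
  move=> j0 jL; have := TA0 ord0 j; rewrite Tcol0// rmorph0 mulr0 => /eqP.
  by rewrite mulf_eq0 (negbTE (d_neq0 j)) orbF => /eqP.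
have a_real : (T ord0 ord0)^* = T ord0 ord0.
  have := TA0 ord0 ord0; rewrite mulrC => /(mulfI (d_neq0 _)) H.
  by rewrite -H.
have AkL k i : A k i ord_max = A k (rev_ord i) ord0 by rewrite -(Aflip k i) revL.
(* For L = 0 the matrices I and J coincide, so b = 0 is a possible choice. *)
have [L0|L_neq0] := eqVneq (ord_max : 'I_L.+1) ord0.
  have I0 (i : 'I_L.+1) : i = ord0.
    by apply/val_inj/eqP; rewrite -leqn0 -ltnS; have := congr1 val L0 => /= <-.
  exists (T ord0 ord0), 0; split; rewrite ?rmorph0//.
  apply/matrixP => i j; rewrite (I0 i) (I0 j) !mxE eqxx mul0r addr0 mulr1 //.
(* Entry (i, 0) of T A_k = A_k T^*: on the left only h = k survives, on the right only h = 0 and h =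
   L, because row 0 of T vanishes elsewhere. *)
have TE i k : T i k = T ord0 ord0 * (i == k)%:R + (T ord0 ord_max)^* * (i == rev_ord k)%:R.
  apply: (mulIf (Acol_neq0 k)).
  have := TAE k i ord0; rewrite (bigD1 k)//= big1 ?addr0; last first.
    by move=> h hk; rewrite Acol0 ?mulr0.
  move=> ->; rewrite (bigD1 ord0)//= (bigD1 ord_max)//= big1 ?addr0; last first.
    by move=> h /andP[h0 hL]; rewrite Trow0// rmorph0 mulr0.
  rewrite a_real AkL mulrDl.
  have AE h : A k h ord0 = (h == k)%:R * A k k ord0.
    by have [->|hk] := eqVneq h k; rewrite ?mul1r// Acol0// mul0r.
  rewrite (AE i) (AE (rev_ord i)) (can2_eq rev_ordK rev_ordK).
  by congr (_ + _); rewrite [LHS]mulrC mulrA.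
(* At the entry (0, L) the formula [TE] equates this corner entry with its own conjugate. *)
have b_real : (T ord0 ord_max)^* = T ord0 ord_max.
  by rewrite [RHS]TE revL eqxx (eq_sym ord0) (negbTE L_neq0) mulr0 add0r mulr1.
exists (T ord0 ord0), (T ord0 ord_max); split => //.
by apply/matrixP => i k; rewrite TE !mxE b_real.
Qed.

(** * The commutants of the weight measure *)

Lemma weightE {R : realType} (L : nat) (nu x : R) :
  weight L nu x = alpha_mx L nu (fun d => gegenbauer nu d x).
Proof. by apply/matrixP => i j; rewrite !mxE. Qed.

Lemma weight_flip {R : realType} (L : nat) (nu x : R) (i j : 'I_L.+1) : 0 < nu ->
  weight L nu x (rev_ord i) (rev_ord j) = weight L nu x i j.
Proof. by move=> nu_gt0; rewrite weightE alpha_mx_flip. Qed.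

(** * From the measure to the coefficient matrices *)

Lemma continuous_weight {R : realType} (L : nat) (nu : R) (i j : 'I_L.+1) :
  continuous (fun x => weight L nu x i j).
Proof.
pose p := \sum_(d < L.+1) (alpha_mx L nu (indic d) i j / d`!%:R) *: gegenbauer_poly nu d.
have -> : (fun x => weight L nu x i j) = horner p.
  apply/funext => x; rewrite weightE alpha_mx_expand summxE horner_sum.
  by apply: eq_bigr => d _; rewrite mxE hornerZ gegenbauerE; ring.
exact: continuous_horner.
Qed.

(** For nu < 1/2 the density may be unbounded near the endpoints, hence the restriction to the open
    interval. *)
Lemma continuous_weight_density {R : realType} (L : nat) (nu x : R) (i j : 'I_L.+1) :
  0 < 1 - x ^+ 2 ->
  {for x, continuous (fun x => weight L nu x i j * (1 - x ^+ 2) `^ (nu - 2^-1))}.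
Proof.
move=> x1; apply: cvgM; first exact: continuous_weight.
have H := is_derive1_powR (nu - 2^-1) x1.
apply: (@continuous_comp _ _ _ (fun x : R => 1 - x ^+ 2) (fun y : R => y `^ (nu - 2^-1))).
  by apply: cvgB; [exact: cvg_cst|exact: exprn_continuous].
by apply/differentiable_continuous/derivable1_diffP; case: H.
Qed.

(** The hypothesis is used for X = [-1/2, y]; the fundamental theorem of calculus recovers the
    integrand at x, and the positive scalar weight is divided out. *)
Lemma weight_lincomb_eq0 {R : realType} (L : nat) (nu : R) (c : 'I_L.+1 -> 'I_L.+1 -> R) :
  0 < nu ->
  (forall X : set R, measurable X ->
     \sum_i \sum_j c i j * \int[lebesgue_measure]_(x in X `&` `[-1, 1])
       (weight L nu x i j * (1 - x ^+ 2) `^ (nu - 2^-1)) = 0) ->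
  forall x, - 2^-1 < x < 2^-1 -> \sum_i \sum_j c i j * weight L nu x i j = 0.
Proof.
move=> nu_gt0 cI x /andP[x1 x2].
pose f i j x := weight L nu x i j * (1 - x ^+ 2) `^ (nu - 2^-1).
pose F i j y := \int[lebesgue_measure]_(x in `[- 2^-1, y]) f i j x.
have sq_lt1 (y : R) : - 2^-1 <= y -> y <= 2^-1 -> 0 < 1 - y ^+ 2.
  by move=> y1 y2; rewrite expr2; nra.
have dF i j : is_derive x 1 (F i j) (f i j x).
  have intf : lebesgue_measure.-integrable `[- 2^-1, 2^-1] (EFin \o f i j).
    apply: continuous_compact_integrable; first exact: segment_compact.
    apply: continuous_in_subspaceT => y; rewrite inE /= in_itv /= => /andP[y1 y2].
    by apply: continuous_weight_density; exact: sq_lt1.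
  have [] := @continuous_FTC1_closed R (f i j) (- 2^-1) x 2^-1 x2 intf x1 _.
    by apply: continuous_weight_density; apply: sq_lt1; exact: ltW.
  by move=> dF; rewrite derive1E => <-; exact: DeriveDef.
have dS := is_derive_sum (fun i => is_derive_sum (fun j => is_deriveZ (c i j) (dF i j))).
have S0 : \forall y \near x, (\sum_i \sum_j c i j *: F i j) y = cst 0 y.
  near=> y; rewrite /= -[RHS](cI `[- 2^-1, y]%classic); last exact: measurable_itv.
  rewrite fct_sumE; apply: eq_bigr => i _; rewrite fct_sumE; apply: eq_bigr => j _.
  congr (_ * Rintegral _ _ _).
  (* For y < 1/2, intersecting with [-1, 1] changes nothing. *)
  apply/seteqP; split => z /=; rewrite !in_itv /=; last by case.
  move=> /andP[z1 zy]; split; first by rewrite z1.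
  have : y < 2^-1 by near: y; exact: lt_nbhsl.
  lra.
have : \sum_i \sum_j c i j *: f i j x = 0.
  by case: dS => _ <-; rewrite (near_eq_derive _ S0) derive_cst.
have w_gt0 : 0 < (1 - x ^+ 2) `^ (nu - 2^-1).
  by rewrite powR_gt0// sq_lt1// ltW.
under eq_bigr => i _ do under eq_bigr => j _ do rewrite /f /GRing.scale /= mulrA.
under eq_bigr => i _ do rewrite -mulr_suml.
rewrite -mulr_suml => /eqP; rewrite mulf_eq0 (gt_eqF w_gt0) orbF => /eqP.
by [].
Unshelve. all: by end_near. Qed.

Lemma alpha_mx_lincomb_eq0 {R : realType} (L : nat) (nu : R) (c : 'I_L.+1 -> 'I_L.+1 -> R) :
  0 < nu ->
  (forall X : set R, measurable X ->
     \sum_i \sum_j c i j * \int[lebesgue_measure]_(x in X `&` `[-1, 1])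
       (weight L nu x i j * (1 - x ^+ 2) `^ (nu - 2^-1)) = 0) ->
  forall d, (d <= L)%N -> \sum_i \sum_j c i j * alpha_mx L nu (indic d) i j = 0.
Proof.
move=> nu_gt0 cI.
apply: (@gegenbauer_free R nu L (fun d => \sum_i \sum_j c i j * alpha_mx L nu (indic d) i j) nu_gt0).
move=> x xI; rewrite -[RHS](@weight_lincomb_eq0 R L nu c nu_gt0 cI x xI).
under eq_bigr do rewrite mulr_suml.
rewrite exchange_big; apply: eq_bigr => i _.
under eq_bigr do rewrite mulr_suml.
rewrite exchange_big; apply: eq_bigr => j _.
rewrite weightE alpha_mx_expand summxE mulr_sumr; apply: eq_bigr => d _.
by rewrite [X in _ = _ * X]mxE mulrA mulrAC.
Qed.

(** The weight is real, so the real and imaginary parts of the coefficients satisfy the hypothesis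
    separately. *)
Lemma alpha_mx_clincomb_eq0 {R : realType} (L : nat) (nu : R) (z : 'I_L.+1 -> 'I_L.+1 -> R[i]) :
  0 < nu ->
  (forall X : set R, measurable X ->
     \sum_i \sum_j z i j * weight_measure L nu X i j = 0) ->
  forall d, (d <= L)%N ->
    \sum_i \sum_j z i j * (alpha_mx L nu (indic d) i j)%:C%C = 0.
Proof.
move=> nu_gt0 zI.
have ReE (M : 'I_L.+1 -> 'I_L.+1 -> R) :
    complex.Re (\sum_i \sum_j z i j * (M i j)%:C%C) =
    \sum_i \sum_j complex.Re (z i j) * M i j.
  rewrite raddf_sum; apply: eq_bigr => i _; rewrite raddf_sum; apply: eq_bigr => j _.
  by case: (z i j) => a b /=; rewrite mulr0 subr0.
have ImE (M : 'I_L.+1 -> 'I_L.+1 -> R) :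
    complex.Im (\sum_i \sum_j z i j * (M i j)%:C%C) =
    \sum_i \sum_j complex.Im (z i j) * M i j.
  rewrite raddf_sum; apply: eq_bigr => i _; rewrite raddf_sum; apply: eq_bigr => j _.
  by case: (z i j) => a b /=; rewrite mulr0 add0r.
have zI' (X : set R) : measurable X -> \sum_i \sum_j z i j * (\int[lebesgue_measure]_(x in X `&` `[-1, 1])
       (weight L nu x i j * (1 - x ^+ 2) `^ (nu - 2^-1)))%:C%C = 0.
  move=> mX; rewrite -[RHS](zI X mX).
  by apply: eq_bigr => i _; apply: eq_bigr => j _; rewrite mxE.
move=> d dL; apply/eqP; rewrite eq_complex; apply/andP; split; apply/eqP.
  rewrite ReE (alpha_mx_lincomb_eq0 L nu (fun i j => complex.Re (z i j)))// => X mX.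
  by have := congr1 (@complex.Re R) (zI' X mX); rewrite ReE.
rewrite ImE (alpha_mx_lincomb_eq0 L nu (fun i j => complex.Im (z i j)))// => X mX.
by have := congr1 (@complex.Im R) (zI' X mX); rewrite ImE.
Qed.

(** Each entry of T M - M T^* is linear in the entries of M with coefficients depending on T alone,
    so its vanishing passes from the measure to every A_d. *)
Lemma sum_twisted_commutator {C : numClosedFieldType} (n : nat) (T M : 'M[C]_n) (i j : 'I_n) :
  \sum_k \sum_l (T i k *+ (l == j) - (T j l)^* *+ (k == i)) * M k l =
  (T *m M - M *m T ^t*) i j.
Proof.
under eq_bigr do under eq_bigr do rewrite mulrBl.
under eq_bigr do rewrite sumrB.
rewrite sumrB !mxE; congr (_ - _).
  apply: eq_bigr => k _; rewrite (bigD1 j)//= eqxx big1 ?addr0// => l /negbTE ->.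
  by rewrite mul0r.
rewrite (bigD1 i)//= [X in _ + X]big1 ?addr0.
  by apply: eq_bigr => l _; rewrite eqxx !mxE mulrC.
by move=> k /negbTE ->; apply: big1 => l _; rewrite mul0r.
Qed.

Lemma real_commutant_sub_span {R : realType} (L : nat) (nu : R) : 0 < nu ->
  (real_commutant (weight_measure L nu) `<=`
   real_span2 (1%:M : 'M[R[i]]_(L.+1)) (flip_mx R L.+1))%classic.
Proof.
move=> nu_gt0 T TTheta.
pose A (k : 'I_L.+1) : 'M[R[i]]_L.+1 := \matrix_(i, j) (alpha_mx L nu (indic k) i j)%:C%C.
have TA k : T *m A k = A k *m T ^t*.
  apply/eqP; rewrite -subr_eq0; apply/eqP/matrixP => i j.
  rewrite -sum_twisted_commutator mxE.
  have kL : (k <= L)%N by rewrite -ltnS.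
  rewrite -[RHS](@alpha_mx_clincomb_eq0 R L nu
     (fun k l => T i k *+ (l == j) - (T j l)^* *+ (k == i)) nu_gt0 _ k kL).
    by apply: eq_bigr => h _; apply: eq_bigr => l _; rewrite [in LHS]mxE.
  by move=> X mX; rewrite sum_twisted_commutator TTheta// subrr mxE.
have AE k i j : A k i j = (alpha_mx L nu (indic k) i j)%:C%C by rewrite mxE.
have [||i j ij||i j ij|k|k i ik|i i0 iL|//|a [b [aR bR ->]]] := @twisted_commutant_rigid _ L A T.
- by move=> k i j; rewrite !AE alpha_mx_flip.
- move=> i; rewrite AE alpha_mx_indic0 eqxx mul1r ltcR alpha_gt0//.
    by rewrite -ltnS.
  by rewrite leq_add2r -ltnS.
- by rewrite AE alpha_mx_indic0 (negbTE ij) mul0r.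
- move=> i; rewrite AE alpha_mx_indicL eqxx mul1r ltcR.
  have iL := ltn_ord i.
  by case: leqP => iLi; rewrite alpha_gt0//; lia.
- by rewrite AE alpha_mx_indicL (negbTE ij) mul0r.
- have kL := ltn_ord k.
  have a_gt0 : 0 < alpha L nu 0 0 k by apply: alpha_gt0 => //; lia.
  by rewrite AE alpha_mx_indic_col0 eqxx mul1r gt_eqF ?ltcR.
- by rewrite AE alpha_mx_indic_col0 val_eqE (negbTE ik) mul0r.
- have iL' := ltn_ord i.
  have i_gt0 : (0 < i)%N by rewrite lt0n.
  have i_ltL : (i < L)%N by rewrite ltn_neqAle -ltnS iL' andbT.
  rewrite !AE !alpha_mx_indic0 !alpha_mx_indicL !eqxx !mul1r /= subn0.
  have sepR x y z w : x * y < z * w -> x%:C%C * y%:C%C != z%:C%C * w%:C%C :> R[i].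
    by move=> lt_xy; rewrite -!(rmorphM (real_complex R)) lt_eqF ?ltcR.
  apply: sepR.
  case: leqP => iLi; first exact: alpha_ratio_lt.
  (* In the lower half the inequality is taken at L - i, and the diagonal entry is carried there by
     the flip symmetry. *)
  have := @alpha_ratio_lt R L nu (L - i) nu_gt0.
  rewrite subKn ?(ltnW i_ltL)// => H.
  rewrite -(@alpha_flip _ _ _ i i i)//; try lia.
  have -> : (L + i - (i + i) = L - i)%N by lia.
  by apply: H; lia.
- have ReE (x : R[i]) : x^* = x -> x = (complex.Re x)%:C%C.
    case: x => x y /eqP; rewrite eq_complex /= => /andP[_ /eqP y0].
    by apply/eqP; rewrite eq_complex /= eqxx /=; apply/eqP; lra.
  exists (complex.Re a), (complex.Re b).
  by rewrite -!ReE.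
Qed.

Lemma span_sub_hermitian_commutant {R : realType} (L : nat) (nu : R) : 0 < nu ->
  (real_span2 (1%:M : 'M[R[i]]_(L.+1)) (flip_mx R L.+1) `<=`
   hermitian_commutant (weight_measure L nu))%classic.
Proof.
move=> nu_gt0 _ [a [b ->]]; split.
  move=> X mX; rewrite mulmxDl mulmxDr -!scalemxAl -!scalemxAr mul1mx mulmx1.
  congr (_ + _ *: _); apply/matrixP => i j; rewrite !mxE.
  (* Multiplying by J on the left reverses the row index, on the right the column index; the two
     results agree by [weight_flip]. *)
  rewrite (bigD1 (rev_ord i))//= big1 ?addr0; last first.
    by move=> k ki; rewrite !mxE -(can2_eq rev_ordK rev_ordK) eq_sym (negbTE ki) mul0r.
  rewrite (bigD1 (rev_ord j))//= big1 ?addr0; last first.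
    by move=> k kj; rewrite !mxE (negbTE kj) mulr0.
  rewrite !mxE rev_ordK !eqxx mul1r mulr1; congr (_%:C%C).
  apply: eq_Rintegral => x _.
  by rewrite -[in LHS](rev_ordK j) weight_flip// rev_ordK.
apply/is_hermitianmxP; rewrite expr0 scale1r.
have conjR (x : R) : (x%:C%C : R[i])^* = x%:C%C := conjc_real x.
(* I and J are real symmetric and the coefficients are real. *)
apply/matrixP => i j; rewrite !mxE rmorphD !rmorphM /= !conjR !rmorph_nat.
by rewrite (eq_sym j i) [i == rev_ord j]eq_sym (can2_eq rev_ordK rev_ordK).
Qed.

Lemma hermitian_sub_real_commutant {R : realType} (N : nat) (Theta : set R -> 'M[R[i]]_N) :
  (hermitian_commutant Theta `<=` real_commutant Theta)%classic.
Proof.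
move=> T [TTheta /is_hermitianmxP]; rewrite expr0 scale1r => TE X mX.
by rewrite -TE TTheta.
Qed.

(* L = 2l *)
Theorem mainTheorem2 (R : realType) (L : nat) (nu : R) (nu_gt0 : 0 < nu) :
  real_commutant (weight_measure L nu) =
    hermitian_commutant (weight_measure L nu) /\
  hermitian_commutant (weight_measure L nu) =
    real_span2 (1%:M : 'M[R[i]]_(L.+1)) (flip_mx R L.+1).
Proof.
(* Three inclusions form a cycle, so all three sets coincide. *)
have RS := real_commutant_sub_span L nu nu_gt0.
have SH := span_sub_hermitian_commutant L nu nu_gt0.
have HR := @hermitian_sub_real_commutant R L.+1 (weight_measure L nu).
by split; apply/seteqP; split => // T; [move=> /RS/SH|move=> /HR/RS].
Qed.
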